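(* Let $\{\sigma_q\}_{q\in\mathbb{Q}_1}$ be the semibranching system on $(\mathbb{P}^1_{\mathrm{Berk}}(\mathbb{C}_p),\mu_G)$ associated to the coding map given by the shift $\sigma:\mathbb{P}^1_{\mathrm{Berk}}(\mathbb{C}_p)\to\mathbb{P}^1_{\mathrm{Berk}}(\mathbb{C}_p)$. Then the Perron-Frobenius operator $P_\sigma$ is of the form $$(P_\sigma\xi)(x)=\sum_{q\in\mathbb{Q}_1}\chi_{F(q)}(x)\,\xi(\sigma_q(x)).$$
   Context: Let $\mathbb{Q}_1=\mathbb{Q}\cap(0,1)$, enumerated as $(q_n)_{n\ge1}$, and let $b_n\in[0,1]$ with $q_n<b_n$ and $b_n-q_n\to0$. Let $f:[0,1]\to2^{[0,1]}$ be the set-valued (comb) function with graph $\{(t,t):t\in[0,1]\}\cup\bigcup_n[q_n,b_n]\times\{q_n\}$, and $X=\{(x_1,x_2,\dots)\in[0,1]^{\mathbb{N}}:x_k\in f(x_{k+1})\ \forall k\}$. This is homeomorphic to Ważewski's universal dendrite, with which $\mathbb{P}^1_{\mathrm{Berk}}(\mathbb{C}_p)$ is identified, so its points are sequences. The shift is $\sigma(x_1,x_2,\dots)=(x_2,x_3,\dots)$. For $q\in\mathbb{Q}_1$, $F(q)=\{x\in\mathbb{P}^1_{\mathrm{Berk}}(\mathbb{C}_p):qx\in\mathbb{P}^1_{\mathrm{Berk}}(\mathbb{C}_p)\}$, $Z(q)=\{qx\in\mathbb{P}^1_{\mathrm{Berk}}(\mathbb{C}_p):x\in\mathbb{P}^1_{\mathrm{Berk}}(\mathbb{C}_p)\}$,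 and $\sigma_q:F(q)\to Z(q)$, $\sigma_q(x)=qx$, where $qx$ is the sequence $x$ with $q$ prepended. $\mu_G$ denotes the non-zero, strictly positive Radon measure on $\mathbb{P}^1_{\mathrm{Berk}}(\mathbb{C}_p)$ invariant under the action of $\mathrm{PGL}_2(\mathbb{C}_p)$ by Möbius transformations; its existence is a standing assertion of the setting. It is also part of the setting that $\{\sigma_q\}$ is a semibranching system with coding map $\sigma$, meaning that the ranges $Z(q)$ cover the space up to a $\mu_G$-null set and have pairwise $\mu_G$-null intersections, that the Radon-Nikodym derivatives $\frac{d(\mu_G\circ\sigma_q)}{d\mu_G}$ exist and are positive a.e. on $F(q)$ (they equal $1$), and that $\sigma\circ\sigma_q=\mathrm{id}$ on $F(q)$. The transfer operator $T_\sigma$ on $L^2(\mathbb{P}^1_{\mathrm{Berk}}(\mathbb{C}_p),\mu_G)$ is $(T_\sigma\psi)(x)=\psi(\sigma(x))$; the Perron-Frobenius operator $P_\sigma$ is its adjoint, $\int\psi\,P_\sigma(\xi)\,d\mu_G=\int T_\sigma(\psi)\,\xi\,d\mu_G$. *)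

(* Defs.v *)
From HB Require Import structures.
From mathcomp Require Import all_boot all_order all_algebra.
From mathcomp Require Import all_classical all_reals all_analysis.
From mathcomp Require Import measurable_realfun complex.

Set Implicit Arguments.
Unset Strict Implicit.
Unset Printing Implicit Defensive.

Import Order.TTheory GRing.Theory Num.Theory.
Import numFieldNormedType.Exports.

Local Open Scope classical_set_scope.
Local Open Scope ring_scope.

(* The field C_p as a completion of an algebraic closure of Q_p: an
   algebraically closed complete ultrametric field with |p| = 1/p in which
   the elements algebraic over Q_p (the closure of the prime field Q) are
   dense. These conditions determine C_p up to isometric isomorphism. *)

Section PadicComplex.
Variables (R : realType) (K : closedFieldType) (abs : K -> R).

Definition padic_numbers : set K :=
  [set x | forall e : R, 0 < e -> exists r : rat, abs (x - ratr r) < e].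

Definition algebraic_over_padic : set K :=
  [set x | exists2 f : {poly K}, f != 0 /\ root f x &
     forall i, padic_numbers f`_i].

Record is_padic_complex (p : nat) : Prop := IsPadicComplex {
  pc_abs_ge0 : forall x, 0 <= abs x ;
  pc_abs_eq0 : forall x, abs x = 0 <-> x = 0 ;
  pc_absM : forall x y, abs (x * y) = abs x * abs y ;
  pc_absD : forall x y, abs (x + y) <= Num.max (abs x) (abs y) ;
  pc_absp : abs p%:R = p%:R^-1 ;
  pc_complete : forall u : nat -> K,
    (forall e : R, 0 < e -> exists N, forall m n,
       (N <= m)%N -> (N <= n)%N -> abs (u m - u n) < e) ->
    exists l, forall e : R, 0 < e -> exists N, forall n,
      (N <= n)%N -> abs (u n - l) < e ;
  pc_dense : forall x (e : R), 0 < e ->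
    exists2 y, algebraic_over_padic y & abs (x - y) < e }.

End PadicComplex.

Record padic_complex (R : realType) (p : nat) := PadicComplex {
  pc_field :> closedFieldType ;
  pc_abs : pc_field -> R ;
  pc_axioms : is_padic_complex pc_abs p }.

(* The Berkovich projective line: the one-point compactification of the
   Berkovich affine line, i.e. of the space of multiplicative seminorms on
   K[T] extending the absolute value of K, with the topology of pointwise
   convergence. *)

Section Berkovich.
Variables (R : realType) (p : nat) (K : padic_complex R p).

Record mult_seminorm (s : {poly K} -> R) : Prop := MultSeminorm {
  ms_ge0 : forall f, 0 <= s f ;
  ms_const : forall c : K, s c%:P = pc_abs c ;
  ms_mul : forall f g, s (f * g) = s f * s g ;
  ms_add : forall f g, s (f + g) <= s f + s g }.

Definition A1Berk : Type :=
  [set s : prod_topology (fun _ : {poly K} => R) | mult_seminorm s].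

HB.instance Definition _ := Topological.on A1Berk.

Definition P1Berk : Type := one_point_compactification A1Berk.

HB.instance Definition _ := Topological.on P1Berk.

Definition A1Berk_of s (H : mult_seminorm s) : A1Berk := exist _ s (mem_set H).

Lemma seminormE (x : A1Berk) : mult_seminorm (val x).
Proof. by case: x => s /= /set_mem. Qed.

(* [mobius g] is the action on P1Berk of the class in PGL_2(K) of the
   invertible matrix g = (a b; c d), i.e. the continuous extension of
   z |-> (a z + b) / (c z + d).  It sends a seminorm s to
   f |-> s(f((a T + b)/(c T + d))), where s is extended to the rational
   functions whose denominator is a power of c T + d. *)

Definition mobius_num (g : 'M[K]_2) : {poly K} :=
  g ord0 ord0 *: 'X + (g ord0 ord_max)%:P.
Definition mobius_den (g : 'M[K]_2) : {poly K} :=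
  g ord_max ord0 *: 'X + (g ord_max ord_max)%:P.

(* (c T + d)^n f((a T + b)/(c T + d)), for n >= deg f *)
Definition mobius_subst (g : 'M[K]_2) (n : nat) (f : {poly K}) : {poly K} :=
  \sum_(i < n.+1)
     f`_i *: (mobius_num g ^+ i * mobius_den g ^+ (n - i)).

Definition mobius_seminorm (g : 'M[K]_2) (s : {poly K} -> R) : {poly K} -> R :=
  fun f => s (mobius_subst g (size f).-1 f) / s (mobius_den g) ^+ (size f).-1.

Definition point_seminorm (z : K) : {poly K} -> R := fun f => pc_abs f.[z].

Lemma pc_abs0 : pc_abs (0 : K) = 0.
Proof. exact/(pc_abs_eq0 (pc_axioms K)). Qed.

Lemma pc_abs1 : pc_abs (1 : K) = 1.
Proof.
have /eqP := pc_absM (pc_axioms K) 1 1.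
rewrite mulr1 -{1}[pc_abs _]mulr1 => /eqP/mulfI -> //.
by apply/eqP => /(pc_abs_eq0 (pc_axioms K))/eqP; rewrite oner_eq0.
Qed.

Lemma point_seminormP z : mult_seminorm (point_seminorm z).
Proof.
have [ge0 _ aM aD _ _ _] := pc_axioms K.
split=> [f|c|f g|f g]; rewrite /point_seminorm.
- exact: ge0.
- by rewrite hornerC.
- by rewrite hornerM aM.
- by rewrite hornerD (le_trans (aD _ _))// ge_max lerDl lerDr !ge0.
Qed.

Lemma mobius_seminormP g s : mult_seminorm s -> s (mobius_den g) != 0 ->
  mult_seminorm (mobius_seminorm g s).
Proof.
move=> sP d0; have [ge0 sC sM sD] := sP.
have den0 : mobius_den g != 0.
  by apply: contraNneq d0 => ->; rewrite -polyC0 sC pc_abs0.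
have s1 : s 1 = 1 by rewrite -polyC1 sC pc_abs1.
have sX f n : s (f ^+ n) = s f ^+ n.
  by elim: n => [|n IH]; rewrite ?expr0 // !exprS sM IH.
pose P := tofrac (mobius_num g); pose Q := tofrac (mobius_den g).
have Q0 : Q != 0 by rewrite /Q tofrac_eq0.
pose emb (f : {poly K}) := map_poly (@tofrac {poly K} \o @polyC K) f.
have aux (F : fieldType) (x u v w : F) : v != 0 ->
    x * (u * w) = w * v * (x * (u / v)).
  move=> v0; rewrite -[w * v]mulrC mulrACA [v * x]mulrC -mulrA.
  by rewrite [v * _]mulrC -[w * _ * v]mulrA divfK// [w * u]mulrC.
have substE (f : {poly K}) n : (size f <= n.+1)%N ->
    tofrac (mobius_subst g n f) = Q ^+ n * (emb f).[P / Q].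
  move=> sf; rewrite /mobius_subst rmorph_sum (@horner_coef_wide _ n.+1); last first.
    exact: leq_trans (size_poly _ _) sf.
  rewrite mulr_sumr; apply: eq_bigr => i _.
  rewrite coef_map_id0 /=; last by rewrite polyC0 tofrac0.
  rewrite -mul_polyC !rmorphM !rmorphXn /= -/P -/Q expr_div_n.
  have -> : Q ^+ n = Q ^+ (n - i) * Q ^+ i by rewrite -exprD subnK // -ltnS.
  by apply: aux; rewrite expf_neq0.
have Qs (n : nat) : s (mobius_den g) ^+ n != 0 by rewrite expf_neq0.
have msE (f : {poly K}) n : (size f <= n.+1)%N ->
    mobius_seminorm g s f = s (mobius_subst g n f) / s (mobius_den g) ^+ n.
  move=> sf; set m := (size f).-1.
  have mn : (m <= n)%N by rewrite /m; case: (size f) sf.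
  have -> : mobius_subst g n f = mobius_den g ^+ (n - m) * mobius_subst g m f.
    apply/eqP; rewrite -tofrac_eq rmorphM rmorphXn /= substE// substE ?leqSpred//.
    by rewrite mulrA -exprD subnK.
  rewrite /mobius_seminorm -/m sM sX -[in RHS](subnK mn) exprD addnK invfM.
  by rewrite mulrACA mulfV// mul1r.
have embD f h : emb (f + h) = emb f + emb h by rewrite /emb rmorphD.
have embM f h : emb (f * h) = emb f * emb h by rewrite /emb rmorphM.
split=> [f|c|f h|f h].
- by rewrite divr_ge0// exprn_ge0.
- rewrite (@msE _ 0%N) ?size_polyC ?leq_b1// expr0 divr1 -sC; congr s.
  by rewrite /mobius_subst big_ord1 coefC /= !expr0 mulr1 alg_polyC.
- rewrite (@msE _ ((size f).-1 + (size h).-1)%N); last first.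
    apply: leq_trans (size_polyMleq _ _) _.
    by case: (size f) (size h) => [|m] [|n] //=; rewrite ?addnS ?addSn ?addn0 //= leqW// ?leq_pred.
  rewrite /mobius_seminorm.
  have -> : mobius_subst g ((size f).-1 + (size h).-1) (f * h) =
            mobius_subst g (size f).-1 f * mobius_subst g (size h).-1 h.
    apply/eqP; rewrite -tofrac_eq rmorphM /= substE; last first.
      apply: leq_trans (size_polyMleq _ _) _.
      by case: (size f) (size h) => [|m] [|n] //=; rewrite ?addnS ?addSn ?addn0 //= leqW// ?leq_pred.
    by rewrite !substE ?leqSpred// embM hornerM exprD mulrACA.
  by rewrite sM exprD invfM mulrACA.
- set n := maxn (size f).-1 (size h).-1.
  have sf : (size f <= n.+1)%N.
    by apply: leq_trans (leqSpred _) _; rewrite ltnS leq_maxl.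
  have sh : (size h <= n.+1)%N.
    by apply: leq_trans (leqSpred _) _; rewrite ltnS leq_maxr.
  rewrite !(@msE _ n)//; last first.
    by apply: leq_trans (size_polyD _ _) _; rewrite geq_max sf sh.
  rewrite -mulrDl ler_pM2r ?invr_gt0 ?lt_neqAle 1?eq_sym ?Qs ?exprn_ge0//.
  rewrite (_ : mobius_subst g n (f + h) =
    mobius_subst g n f + mobius_subst g n h)//.
  rewrite /mobius_subst -big_split; apply: eq_bigr => i _ /=.
  by rewrite coefD scalerDl.
Qed.

Definition mobius (g : 'M[K]_2) (x : P1Berk) : P1Berk :=
  match x with
  | Some s =>
      if pselect (val s (mobius_den g) != 0) is left d0
      then Some (A1Berk_of (mobius_seminormP (seminormE s) d0))
      else None
  | None =>
      if g ord_max ord0 == 0 then None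
      else Some (A1Berk_of (point_seminormP (g ord0 ord0 / g ord_max ord0)))
  end.

End Berkovich.

Definition homeomorphism (S T : topologicalType) (h : S -> T) : Prop :=
  continuous h /\
  exists k : T -> S, [/\ continuous k, cancel h k & cancel k h].

Definition Q1 : set rat := [set r | 0 < r < 1].

Section Comb.
Variables (R : realType) (q : nat -> rat) (b : nat -> R).

Definition comb_graph : set (R * R) :=
  [set tt | exists2 t, 0 <= t <= 1 & tt = (t, t)] `|`
  \bigcup_n [set ts | ratr (q n) <= ts.1 <= b n /\ ts.2 = ratr (q n)].

Definition comb (t : R) : set R := [set s | comb_graph (t, s)].

Definition comb_seq : set (prod_topology (fun _ : nat => R)) :=
  [set x | (forall k, 0 <= x k <= 1) /\ (forall k, comb (x k.+1) (x k))].

Definition combX : Type := comb_seq.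

HB.instance Definition _ := Topological.on combX.

Lemma comb_seq0 : comb_seq (fun=> 0).
Proof.
by split=> k; rewrite ?lexx ?ler01//; left; exists 0; rewrite ?lexx ?ler01.
Qed.

(* only because measurable types are pointed *)
HB.instance Definition _ :=
  isPointed.Build combX (exist _ (fun=> 0) (mem_set comb_seq0)).

HB.instance Definition _ :=
  Measurable.copy combX (g_sigma_algebraType (@open combX)).

Lemma comb_seq_shift (x : combX) : comb_seq (fun k => val x k.+1).
Proof. by case: x => x /= /set_mem [x01 xf]; split. Qed.

Definition seq_shift (x : combX) : combX :=
  exist _ (fun k => val x k.+1) (mem_set (comb_seq_shift x)).

Definition prepend (r : rat) (x : combX) : nat -> R :=
  fun k => if k is k'.+1 then val x k' else ratr r.

Definition Fdom (r : rat) : set combX := [set x | comb_seq (prepend r x)].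

(* total function with the value x outside F(r) *)
Definition branch (r : rat) (x : combX) : combX :=
  if pselect (comb_seq (prepend r x)) is left H
  then exist _ (prepend r x) (mem_set H) else x.

End Comb.

Section Measures.
Context {d : measure_display} {T : measurableType d} {R : realType}.
Variable mu : {measure set T -> \bar R}.

(* phi is a Radon-Nikodym derivative d(mu o s)/dmu on D *)
Definition RN_derivative (D : set T) (s : T -> T) (phi : T -> \bar R) : Prop :=
  [/\ measurable_fun D phi, (forall x, D x -> (0 <= phi x)%E) &
      forall A, measurable A -> A `<=` D ->
        mu (s @` A) = (\int[mu]_(x in A) phi x)%E].

Record semibranching (I : Type) (J : set I) (D : I -> set T) (s : I -> T -> T)
    (sigma : T -> T) : Prop := Semibranching {
  sb_domain : forall i, J i -> measurable (D i) ;
  sb_range : forall i, J i -> measurable (s i @` D i) ;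
  sb_measurable : forall i, J i -> measurable_fun (D i) (s i) ;
  sb_coding_measurable : measurable_fun setT sigma ;
  sb_cover : mu (~` \bigcup_(i in J) (s i @` D i)) = 0%E ;
  sb_disjoint : forall i j, J i -> J j -> i <> j ->
    mu ((s i @` D i) `&` (s j @` D j)) = 0%E ;
  sb_RN : forall i, J i -> exists2 phi, RN_derivative (D i) (s i) phi &
    {ae mu, forall x, D i x -> (0 < phi x)%E} ;
  sb_coding : forall i x, J i -> D i x -> sigma (s i x) = x }.

(* complex L^2 functions and the integral of complex functions,
   through real and imaginary parts *)
Definition L2 : set (T -> R[i]) :=
  [set f | (fun x => complex.Re (f x)) \in Lfun mu 2%:E /\
           (fun x => complex.Im (f x)) \in Lfun mu 2%:E].

Definition cintegral (f : T -> R[i]) : R[i] :=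
  Complex (\int[mu]_x complex.Re (f x)) (\int[mu]_x complex.Im (f x)).

Definition transfer (sigma : T -> T) (psi : T -> R[i]) : T -> R[i] :=
  fun x => psi (sigma x).

(* When sigma is the coding map of a semibranching system with derivatives 1,
   \int |psi o sigma|^2 = \int |psi|^2 N with N(x) the number of domains
   containing x, so that composition with sigma is unbounded on L^2 when N is.
   It is therefore taken with its natural domain, which is all of L^2 in the
   bounded case; its adjoint is well defined when this domain is dense. *)
Definition transfer_dom (sigma : T -> T) : set (T -> R[i]) :=
  [set psi | L2 psi /\ L2 (transfer sigma psi)].

Definition transfer_densely_defined (sigma : T -> T) : Prop :=
  forall xi, L2 xi -> forall e : R, 0 < e ->
    exists2 psi, transfer_dom sigma psi &
      (\int[mu]_x ((complex.Re (xi x - psi x)) ^+ 2 +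
                   (complex.Im (xi x - psi x)) ^+ 2)%:E < e%:E)%E.

(* The graph of the Perron-Frobenius operator P, the adjoint of [transfer]
   for the bilinear pairing: xi is in the domain of P and P xi = eta. *)
Definition perron_frobenius (sigma : T -> T) (xi eta : T -> R[i]) : Prop :=
  [/\ L2 xi, L2 eta & forall psi, transfer_dom sigma psi ->
    cintegral (fun x => psi x * eta x) =
    cintegral (fun x => transfer sigma psi x * xi x)].

End Measures.

Section CombMeasure.
Variables (R : realType) (q : nat -> rat) (b : nat -> R).
Variable mu : {measure set (combX q b) -> \bar R}.

Definition strictly_positive : Prop :=
  forall U : set (combX q b), open U -> U !=set0 -> (0 < mu U)%E.

(* A Radon measure on the compact space X would moreover be finite. But a
   finite mu that has mu (branch q A) = mu A for A in F(q), and is carried by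
   the union of the Z(q), satisfies mu X = \int #{q | x in F(q)} dmu, which
   is impossible for a strictly positive mu: the integrand is at least 1
   almost everywhere and at least 2 on a nonempty open set. Hence only
   sigma-finiteness is required besides inner regularity; every Radon measure
   on X has both properties. *)
Definition inner_regular : Prop :=
  forall A : set (combX q b), measurable A ->
    mu A = ereal_sup [set mu C | C in [set C | compact C /\ C `<=` A]].

Definition mobius_invariant (p : nat) (K : padic_complex R p)
    (h : combX q b -> P1Berk K) : Prop :=
  forall (g : 'M[K]_2) (A : set (combX q b)), g \in unitmx -> measurable A ->
    mu (h @^-1` (mobius g @` (h @` A))) = mu A.

End CombMeasure.

(* Main.v *)
Require Import Defs.
From HB Require Import structures.
From mathcomp Require Import all_boot all_order all_algebra.
From mathcomp Require Import all_classical all_reals all_analysis.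
From mathcomp Require Import measurable_realfun complex.

Set Implicit Arguments.
Unset Strict Implicit.
Unset Printing Implicit Defensive.

Import Order.TTheory GRing.Theory Num.Theory.
Import numFieldNormedType.Exports.

Local Open Scope classical_set_scope.
Local Open Scope ring_scope.

(** The shift has one inverse branch s_n for each q_n, prepending q_n, and the
range Z_n of s_n is carried back to the domain D_n by the coding map.  As the
Radon-Nikodym derivatives are 1, every branch preserves the measure; as the
ranges tile the space up to a null set, cutting an integral along the Z_n and
carrying each piece back to D_n gives

  \int g = \int \sum_n 1_(D_n)(x) g(s_n x) dmu(x)

for nonnegative g, and then for integrable g ([ge0_integral_branch_sum],
[integral_branch_sum]).  Applied to g = (psi o sigma) xi, where
g(s_n x) = psi(x) xi(s_n x), it says that integrating (psi o sigma) xi is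
integrating psi times the branch sum of xi; so the branch sum of xi is an
adjoint image of xi ([perron_frobenius_of_branch_sum]).

For the converse the adjoint identity is tested on indicators psi = 1_A.  Such
a psi lies in the domain of the transfer operator when A has finite measure
and meets only finitely many D_n, for then the measure of sigma^-1(A) is the
sum of those of the A `&` D_n.  The identity then forces eta and the branch sum
to have the same integral on every subset of such a set, hence to agree almost
everywhere there ([branch_sum_determined]).

It remains that countably many such sets A exhaust the space, that is, that
almost every x lies in finitely many D_n only.  This is where the density of
the domain of the transfer operator enters.  By the displayed formula with
g = |psi o sigma|^2, a psi in the domain makes |psi(x)|^2 #{n | x in D_n}
integrable, so psi vanishes on the set E of points with infinitely many
preimages.  If E were not null, the indicator of a part of E of finite
positive measure could not be approximated by such psi ([ae_finite_overlap]).
In particular the series of the theorem is almost everywhere a finite sum,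
and its convergence is not an issue. *)

(** * Preliminaries on integration *)

Section Preliminaries.
Context d (T : measurableType d) (R : realType) (mu : {measure set T -> \bar R}).

Lemma indicM_patch (f : T -> \bar R) (A : set T) :
  (fun x => (\1_A x)%:E * f x)%E = f \_ A.
Proof. by rewrite epatch_indic; apply/funext => x /=; rewrite muleC. Qed.

Lemma nneseries_finite (u : nat -> \bar R) k : (forall n, 0 <= u n)%E ->
  (forall n, (k <= n)%N -> u n = 0%E) ->
  (\sum_(n <oo) u n = \sum_(0 <= n < k) u n)%E.
Proof.
move=> u0 uk; rewrite (@nneseries_split _ _ 0 k)//.
by rewrite add0n (@eseries0 _ _ k) ?adde0// => n kn _; exact: uk.
Qed.

Lemma Lfun2_indic (A : set T) : measurable A -> (mu A < +oo)%E ->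
  (\1_A : T -> R) \in Lfun mu 2%:E.
Proof.
move=> mA Aoo; rewrite inE; apply/andP; split; rewrite inE/=.
  exact: measurable_indic.
rewrite /finite_norm unlock poweR_lty//.
under eq_integral.
  move=> x _; rewrite /= ger0_norm// powR_mulrn// (_ : _ ^+ 2 = \1_A x); last first.
    by rewrite indicE; case: (_ \in _); rewrite ?expr1n ?expr0n.
  over.
by rewrite integral_indic// setIT.
Qed.

Lemma L2_indic (A : set T) : measurable A -> (mu A < +oo)%E ->
  L2 mu (fun x => Complex (\1_A x : R) 0).
Proof.
move=> mA Aoo; split; first exact: Lfun2_indic.
rewrite (_ : (fun x => _) = \1_set0); last by rewrite indic0.
by apply: Lfun2_indic => //; rewrite measure0.
Qed.

Lemma L2_mul_integrable (f g : T -> R[i]) : L2 mu f -> L2 mu g ->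
  mu.-integrable setT (fun x => (complex.Re (f x * g x))%:E) /\
  mu.-integrable setT (fun x => (complex.Im (f x * g x))%:E).
Proof.
move=> [fr fi] [gr gi].
have prod u v : u \in Lfun mu 2%:E -> v \in Lfun mu 2%:E ->
    mu.-integrable setT (EFin \o (u \* v)).
  by move=> u2 v2; apply/Lfun1_integrable; exact: Lfun2_mul_Lfun1.
split.
- apply: eq_integrable (integrableB measurableT (prod _ _ fr gr) (prod _ _ fi gi)) => //.
  by move=> x _ /=; case: (f x) (g x) => a b [c e].
- apply: eq_integrable (integrableD measurableT (prod _ _ fr gi) (prod _ _ fi gr)) => //.
  by move=> x _ /=; case: (f x) (g x) => a b [c e] /=; rewrite [(b * c)%R]mulrC.
Qed.

End Preliminaries.

(** * Integrals along the branches *)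

Section UnitWeightSystem.
Context d (T : measurableType d) (R : realType) (mu : {measure set T -> \bar R}).
Variables (D : nat -> set T) (s : nat -> T -> T) (sigma : T -> T).
Hypothesis sb : semibranching mu setT D s sigma.
Hypothesis RN1 : forall n, RN_derivative mu (D n) (s n) (cst 1%E).

Local Notation Z n := (s n @` D n).

Let mD n : measurable (D n).
Proof. exact: (sb_domain sb). Qed.

Let mZ n : measurable (Z n).
Proof. exact: (sb_range sb). Qed.

Let mS : measurable_fun setT sigma.
Proof. exact: (sb_coding_measurable sb). Qed.

Let sK n x : D n x -> sigma (s n x) = x.
Proof. exact: (sb_coding sb). Qed.

Let msigma A : measurable A -> measurable (sigma @^-1` A).
Proof. by move=> mA; rewrite -[X in measurable X]setTI; exact: mS. Qed.

Lemma branch_image n (A : set T) : A `<=` D n ->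
  s n @` A = sigma @^-1` A `&` Z n.
Proof.
move=> AD; apply/seteqP; split=> [_ [x Ax <-]|y [/= Ay [x Dx xy]]] /=.
  by split; [rewrite sK//; exact: AD|exists x => //; exact: AD].
by exists x => //; rewrite -(sK Dx) xy.
Qed.

Lemma measure_coding_preimage n (A : set T) : measurable A -> A `<=` D n ->
  mu (sigma @^-1` A `&` Z n) = mu A.
Proof.
move=> mA AD; have [_ _ RN] := RN1 n.
by rewrite -branch_image// RN// integral_cst// mul1e.
Qed.

(** The preceding lemma says that [sigma] pushes the restriction of [mu] to the
range [Z n] forward to its restriction to [D n]; this is the corresponding
change of variables.  It goes through [sigma] rather than through [s n]
because [sigma] is measurable on the whole space. *)
Lemma ge0_integral_coding n (k : T -> \bar R) : measurable_fun (D n) k ->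
  (forall x, D n x -> 0 <= k x)%E ->
  (\int[mu]_(x in Z n) k (sigma x) = \int[mu]_(x in D n) k x)%E.
Proof.
move=> mk k0; pose nu : {measure set T -> \bar R} := mrestr mu (mZ n).
have ZD : Z n `<=` sigma @^-1` D n by move=> _ [x Dx <-] /=; rewrite sK.
have mkS : measurable_fun (sigma @^-1` D n) (k \o sigma).
  apply: (measurable_comp (mD n)) => //; first by move=> _ [x Dx <-].
  exact: measurable_funTS.
have mSD := msigma (mD n).
rewrite (@eq_measure_integral _ _ _ (Z n) nu); last first.
  by move=> A mA AZ; rewrite /nu/= /mrestr setIidl.
rewrite (_ : Z n = sigma @^-1` D n `\` (sigma @^-1` D n `\` Z n)); last first.
  by rewrite setDD setIidr.
rewrite -(@ge0_negligible_integral _ _ _ nu _ _ (k \o sigma))//; first last.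
- by rewrite /nu/= /mrestr setDE -setIA setICl setI0 measure0.
- by move=> x; exact: k0.
- exact: measurableD.
rewrite -(@ge0_integral_pushforward _ _ _ _ _ _ mS)//; last first.
  by move=> x /set_mem; exact: k0.
apply: eq_measure_integral => A mA AD.
by rewrite /nu/= /pushforward /mrestr measure_coding_preimage.
Qed.

Lemma ge0_integral_branch n (g : T -> \bar R) : measurable_fun setT g ->
  (forall x, 0 <= g x)%E ->
  (\int[mu]_(x in D n) g (s n x) = \int[mu]_(x in Z n) g x)%E.
Proof.
move=> mg g0; rewrite -ge0_integral_coding//; last first.
  by apply: (measurableT_comp mg); exact: (sb_measurable sb).
by apply: eq_integral => _ /set_mem[x Dx <-]; rewrite sK.
Qed.

Lemma measurable_branch n (g : T -> \bar R) : measurable_fun setT g ->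
  measurable_fun setT (fun x => (\1_(D n) x)%:E * g (s n x))%E.
Proof.
move=> mg; rewrite (indicM_patch (g \o s n)).
apply/(measurable_restrictT _ (mD n)); apply: (measurableT_comp mg).
exact: (sb_measurable sb).
Qed.

(** The ranges are disjoint and cover the space only up to null sets; countably
many of these are removed at once. *)
Lemma range_ae_unique :
  {ae mu, forall x, exists n, Z n x /\ forall m, m != n -> ~ Z m x}.
Proof.
pose O := \bigcup_m \bigcup_n (if m == n then set0 else Z m `&` Z n).
have : mu.-negligible (~` (\bigcup_n Z n) `|` O).
  apply: negligibleU.
    apply/negligibleP; last exact: (sb_cover sb).
    by apply: measurableC; exact: bigcup_measurable.
  apply: negligible_bigcup => m; apply: negligible_bigcup => n.
  case: eqP => [_|mn]; first exact: negligible_set0.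
  apply/negligibleP; first exact: measurableI.
  exact: (sb_disjoint sb).
apply: negligibleS => x /= Hx; rewrite /O.
have [[n _ Zn]|] := pselect ((\bigcup_n Z n) x); last by left.
right; apply: contrapT => Ox; apply: Hx; exists n; split=> // m mn Zm.
by apply: Ox; exists m => //; exists n => //; rewrite (negbTE mn).
Qed.

(** Almost everywhere exactly one term of \sum_n 1_(Z n) g is nonzero, so that
the integral of [g] splits along the ranges, and each piece is carried back to
a domain. *)
Lemma ge0_integral_branch_sum (g : T -> \bar R) : measurable_fun setT g ->
  (forall x, 0 <= g x)%E ->
  (\int[mu]_x (\sum_(n <oo) (\1_(D n) x)%:E * g (s n x)) = \int[mu]_x g x)%E.
Proof.
move=> mg g0.
have i0 (A : set T) x : (0 <= (\1_A x)%:E :> \bar R)%E by rewrite lee_fin.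
have mZg n : measurable_fun setT (fun x => (\1_(Z n) x)%:E * g x)%E.
  rewrite indicM_patch; apply/(measurable_restrictT _ (mZ n)).
  exact: measurable_funTS.
rewrite integral_nneseries//; last 2 first.
- by move=> n; exact: measurable_branch.
- by move=> n x _; rewrite mule_ge0.
transitivity (\int[mu]_x (\sum_(n <oo) (\1_(Z n) x)%:E * g x))%E.
  rewrite (integral_nneseries mu measurableT mZg); last first.
    by move=> n x _; rewrite mule_ge0.
  apply: eq_eseriesr => n _.
  rewrite (indicM_patch (g \o s n)) (indicM_patch g) -!integral_mkcond.
  exact: ge0_integral_branch.
apply: ge0_ae_eq_integral => //.
- apply: (ge0_emeasurable_sum (P := xpredT)) => [k x _ _|k _]; last exact: mZg.
  by rewrite mule_ge0.
- by move=> x _; apply: nneseries_ge0 => n _ _; rewrite mule_ge0.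
apply: filterS range_ae_unique => x [n [Zn nZ]] _.
rewrite (nneseriesD1 (n := n))//; last by move=> k _; rewrite mule_ge0.
rewrite indicE mem_set// mul1e eseries0 ?adde0// => m _ /andP[_ mn].
by rewrite indicE memNset ?mul0e//; exact: nZ.
Qed.

Lemma measurable_branch_sum (g : T -> \bar R) : measurable_fun setT g ->
  (forall x, 0 <= g x)%E ->
  measurable_fun setT (fun x => \sum_(n <oo) (\1_(D n) x)%:E * g (s n x))%E.
Proof.
move=> mg g0; apply: (ge0_emeasurable_sum (P := xpredT)) => [k x _ _|k _].
  by rewrite mule_ge0 ?lee_fin.
exact: measurable_branch.
Qed.

Lemma ge0_integrable_branch_sum (g : T -> \bar R) :
  mu.-integrable setT g -> (forall x, 0 <= g x)%E ->
  mu.-integrable setT (fun x => \sum_(n <oo) (\1_(D n) x)%:E * g (s n x))%E.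
Proof.
move=> ig g0; have mg := measurable_int _ ig.
apply/integrableP; split; first exact: measurable_branch_sum.
under eq_integral.
  move=> x _; rewrite gee0_abs; last first.
    by apply: nneseries_ge0 => n _ _; rewrite mule_ge0 ?lee_fin.
  over.
rewrite ge0_integral_branch_sum//.
have /integrableP[_] := ig.
by under eq_integral => x _ do rewrite gee0_abs//.
Qed.

(** * Finite branch sums *)

Definition finite_overlap (x : T) := exists k, forall n, (k <= n)%N -> ~ D n x.

(** [y] is the sum of [g (s n x)] over the [n] with [x] in [D n], these being
finitely many.  As a relation it needs no topology and no completeness on [K],
so that it passes from complex functions to their real and imaginary parts by
additivity alone. *)
Definition finite_branch_sum (K : pzRingType) (g : T -> K) (x : T) (y : K) :=
  exists2 k, (forall n, (k <= n)%N -> ~ D n x) &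
    y = series (fun n => \1_(D n) x * g (s n x)) k.

Lemma series_finite_overlap (K : pzRingType) (g : T -> K) x k m :
  (forall n, (k <= n)%N -> ~ D n x) -> (k <= m)%N ->
  series (fun n => \1_(D n) x * g (s n x)) m =
  series (fun n => \1_(D n) x * g (s n x)) k.
Proof.
move=> Dk km; rewrite /series /= (big_cat_nat (leq0n k) km) /=.
rewrite [X in _ + X](_ : _ = 0) ?addr0// big_nat_cond.
rewrite big1// => n /andP[/andP[kn _] _].
by rewrite indicE memNset ?mul0r//; exact: Dk.
Qed.

Lemma finite_branch_sum_unique (K : pzRingType) (g : T -> K) x y z :
  finite_branch_sum g x y -> finite_branch_sum g x z -> y = z.
Proof.
move=> [k Dk ->] [m Dm ->]; have [km|/ltnW mk] := leqP k m.
  by rewrite (series_finite_overlap _ Dk km).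
by rewrite (series_finite_overlap _ Dm mk).
Qed.

Lemma cvg_finite_branch_sum (K : numFieldType) (g : T -> K) x (y : K) :
  finite_overlap x ->
  (series (fun n => \1_(D n) x * g (s n x)) @ \oo --> (y : K^o)) <->
  finite_branch_sum g x y.
Proof.
have cst_cvg k : (forall n, (k <= n)%N -> ~ D n x) ->
    series (fun n => \1_(D n) x * g (s n x)) @ \oo -->
      (series (fun n => \1_(D n) x * g (s n x)) k : K^o).
  move=> Dk; apply: cvg_near_cst; exists k => // m /= km.
  exact: series_finite_overlap.
move=> [k Dk]; split=> [sy|[k' Dk' ->]]; last exact: cst_cvg.
exists k => //; apply: (cvg_unique (@norm_hausdorff _ K^o) sy); exact: cst_cvg.
Qed.

Lemma finite_branch_sum_map (K L : pzRingType) (phi : K -> L) (g : T -> K) x y :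
  phi 0 = 0 -> {morph phi : a b / a + b} ->
  finite_branch_sum g x y -> finite_branch_sum (phi \o g) x (phi y).
Proof.
move=> phi0 phiD [k Dk ->]; exists k => //; rewrite /series /=.
rewrite (big_morph phi phiD phi0); apply: eq_bigr => n _.
by rewrite !indicE; case: (x \in D n); rewrite ?mul1r ?mul0r ?phi0.
Qed.

Lemma finite_branch_sum_of_parts (g : T -> R[i]) x y : finite_overlap x ->
  finite_branch_sum (fun z => complex.Re (g z)) x (complex.Re y) ->
  finite_branch_sum (fun z => complex.Im (g z)) x (complex.Im y) ->
  finite_branch_sum g x y.
Proof.
move=> [k Dk] yr yi; pose z := series (fun n => \1_(D n) x * g (s n x)) k.
have gz : finite_branch_sum g x z by exists k.
have ReD : {morph @complex.Re R : a b / a + b} by move=> [? ?] [? ?].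
have ImD : {morph @complex.Im R : a b / a + b} by move=> [? ?] [? ?].
have Ryz := finite_branch_sum_unique yr (finite_branch_sum_map erefl ReD gz).
have Iyz := finite_branch_sum_unique yi (finite_branch_sum_map erefl ImD gz).
suff -> : y = z by [].
by rewrite [y]complex.complexE [z]complex.complexE Ryz Iyz.
Qed.

(** Since [sigma (s n x) = x], a factor of the form [c \o sigma] is constant on
the preimages of [x] and comes out of the sum. *)
Lemma finite_branch_sum_coding (K : comPzRingType) (c g : T -> K) x y :
  finite_branch_sum g x y ->
  finite_branch_sum (fun z => c (sigma z) * g z) x (c x * y).
Proof.
move=> [k Dk ->]; exists k => //; rewrite /series /= mulr_sumr.
apply: eq_bigr => n _; rewrite indicE.
have [/set_mem Dx|_] := boolP (x \in D n); last by rewrite !mul0r mulr0.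
by rewrite !mul1r sK.
Qed.

(** The branch sums of the positive and negative parts of [g] have finite
integrals by the nonnegative case, and [v] is almost everywhere their
difference. *)
Lemma integral_branch_sum (g v : T -> R) :
  mu.-integrable setT (EFin \o g) -> measurable_fun setT v ->
  {ae mu, forall x, finite_branch_sum g x (v x)} ->
  (\int[mu]_x (v x)%:E = \int[mu]_x (g x)%:E)%E.
Proof.
move=> ig mv vE; have mg := measurable_int _ ig.
pose G := EFin \o g.
pose P x := (\sum_(n <oo) (\1_(D n) x)%:E * G^\+ (s n x))%E.
pose M x := (\sum_(n <oo) (\1_(D n) x)%:E * G^\- (s n x))%E.
have iP : mu.-integrable setT P.
  by apply: ge0_integrable_branch_sum => //; exact: integrable_funepos.
have iM : mu.-integrable setT M.
  by apply: ge0_integrable_branch_sum => //; exact: integrable_funeneg.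
have vPM : ae_eq mu setT (P \- M)%E (EFin \o v).
  have Gn y : (G^\- y)%E \is a fin_num.
    by rewrite funenegE /G maxEle; case: ifP.
  apply: filterS vE => x [k Dk vx] _ /=; rewrite vx.
  have D0 n : (k <= n)%N -> (\1_(D n) x)%:E = 0%E :> \bar R.
    by move=> /Dk Dx; rewrite indicE memNset.
  have i0 n (h : T -> \bar R) : (forall y, 0 <= h y)%E ->
      (0 <= (\1_(D n) x)%:E * h (s n x))%E.
    by move=> h0; rewrite mule_ge0 ?lee_fin.
  rewrite /P /M !(@nneseries_finite _ _ k) => [| | n kn| | n kn];
    [|by move=> n; exact: i0|by rewrite D0 ?mul0e
     |by move=> n; exact: i0|by rewrite D0 ?mul0e].
  rewrite -fin_num_sumeN; last first.
    by move=> n _; rewrite fin_numM.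
  rewrite -big_split /= /series /= -sumEFin; apply: eq_bigr => n _.
  rewrite EFinM -muleBr ?fin_num_adde_defl ?fin_numN//.
  congr (_ * _)%E.
  exact: (esym (congr1 (fun h => h (s n x)) (funeposneg G))).
have mv' : measurable_fun setT (EFin \o v) by exact/measurable_EFinP.
have iPM : mu.-integrable setT (P \- M)%E by exact: integrableB.
have vi : (\int[mu]_x (v x)%:E = \int[mu]_x (P \- M) x)%E.
  apply: ae_eq_integral => //; first exact: measurable_int iPM.
  exact: ae_eq_sym.
rewrite vi integralB// !ge0_integral_branch_sum//; first by rewrite [RHS]integralE.
- exact: measurable_funeneg.
- exact: measurable_funepos.
Qed.

Lemma Rintegral_branch_sum (g v : T -> R) :
  mu.-integrable setT (EFin \o g) -> mu.-integrable setT (EFin \o v) ->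
  {ae mu, forall x, finite_branch_sum g x (v x)} ->
  \int[mu]_x v x = \int[mu]_x g x.
Proof.
move=> ig /measurable_int/measurable_EFinP mv gv.
by rewrite /Rintegral (integral_branch_sum ig mv gv).
Qed.

(** * Finiteness of the overlaps *)

(** This is the Borel-Cantelli lemma for the Dirac measure at [x]. *)
Lemma finite_overlapP x :
  (\sum_(n <oo) (\1_(D n) x)%:E < +oo :> \bar R)%E -> finite_overlap x.
Proof.
move=> Doo; have : (\d_x : {measure set T -> \bar R}) (lim_sup_set D) = 0%E.
  exact: lim_sup_set_cvg0.
rewrite /= diracE; have [_ /eqP|xD _] := boolP (x \in _); first by rewrite onee_eq0.
move: xD; rewrite notin_setE => xD; apply: contrapT => nx; apply: xD => n _.
apply: contrapT => xn; apply: nx; exists n => m nm Dm; apply: xn.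
by exists m.
Qed.

(** With c = |psi x|^2, the branch sum of |psi o sigma|^2 at [x] is c times the
number of domains containing [x]; it is finite almost everywhere because
|psi o sigma|^2 is integrable. *)
Lemma transfer_dom_overlap psi : transfer_dom mu sigma psi ->
  {ae mu, forall x, finite_overlap x \/ psi x = 0}.
Proof.
move=> [_ [/Lfun2_integrable_sqr i1 /Lfun2_integrable_sqr i2]].
have := integrableD measurableT i1 i2; set g := (_ \+ _)%E => ig.
have g0 x : (0 <= g x)%E by rewrite /g/= -EFinD lee_fin addr_ge0// sqr_ge0.
have := integrable_ae measurableT (ge0_integrable_branch_sum ig g0).
apply: filterS => x /(_ Logic.I) gfin.
pose c : R := complex.Re (psi x) ^+ 2 + complex.Im (psi x) ^+ 2.
have c0 : 0 <= c by rewrite addr_ge0// sqr_ge0.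
have [c1|c1] := eqVneq c 0; [right|left].
  move: c1 => /eqP; rewrite /c paddr_eq0 ?sqr_ge0// !sqrf_eq0.
  by case: (psi x) => a b /= /andP[/eqP-> /eqP->].
apply: finite_overlapP; move: gfin.
rewrite (_ : (\sum_(n <oo) _)%E = (c%:E * \sum_(n <oo) (\1_(D n) x)%:E)%E); last first.
  rewrite -nneseriesZl; last by move=> n _; rewrite lee_fin.
  apply: eq_eseriesr => n _; rewrite indicE.
  have [/set_mem Dx|_] := boolP (x \in D n); last by rewrite mul0e mule0.
  by rewrite mul1e mule1 /g /= /transfer sK.
have : (0 <= \sum_(n <oo) (\1_(D n) x)%:E :> \bar R)%E.
  by apply: nneseries_ge0 => n _ _; rewrite lee_fin.
case: (\sum_(n <oo) _)%E => [r _ _||]//; first exact: ltry.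
by move=> _; rewrite gt0_muley// lte_fin lt_neqAle eq_sym c1.
Qed.

(** Functions of the domain vanish where infinitely many [D n] overlap, so they
stay at squared distance at least [mu A] from the indicator of any [A] of
finite measure contained in that set. *)
Lemma ae_finite_overlap : sigma_finite setT mu ->
  transfer_densely_defined mu sigma -> {ae mu, forall x, finite_overlap x}.
Proof.
move=> [F FT Foo] dense; pose E := lim_sup_set D.
have mE : measurable E.
  by apply: bigcap_measurable => // n _; exact: bigcup_measurable.
suff : mu.-negligible (\bigcup_j (E `&` F j)).
  apply: negligibleS => x /= nx; have [j _ Fj] : (\bigcup_j F j) x by rewrite -FT.
  exists j => //; split=> // n _; apply: contrapT => xn; apply: nx.
  by exists n => m nm Dm; apply: xn; exists m.
apply: negligible_bigcup => j; have [mF muF] := Foo j.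
set A := E `&` F j; have mA : measurable A by exact: measurableI.
have Aoo : (mu A < +oo)%E.
  by rewrite (le_lt_trans _ muF)// le_measure ?inE//; exact: subIsetr.
apply/negligibleP => //; apply: contrapT => /eqP A0.
have Afin : mu A \is a fin_num by rewrite ge0_fin_numE.
have e0 : 0 < fine (mu A) by rewrite fine_gt0// Aoo andbT lt0e A0 measure_ge0.
have [psi dpsi] := dense _ (L2_indic mA Aoo) _ e0.
rewrite fineK// ltNge => /negP; apply.
have [[/sub_Lfun_mfun mre /sub_Lfun_mfun mim] _] := dpsi.
rewrite !inE /= in mre mim.
rewrite -[A in mu A]setIT -integral_indic//.
apply: ae_ge0_le_integral => //.
- exact/measurable_EFinP/measurable_indic.
- by move=> x _; rewrite lee_fin addr_ge0// sqr_ge0.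
- apply/measurable_EFinP/measurable_funD; apply: measurable_funX.
    rewrite (_ : (fun x => _) = (\1_A \- (fun x => complex.Re (psi x)))).
      by apply: measurable_funB => //; exact: measurable_indic.
    by apply/funext => x /=; case: (psi x).
  rewrite (_ : (fun x => _) = (\- (fun x => complex.Im (psi x)))).
    exact: measurableT_comp.
  by apply/funext => x /=; case: (psi x) => a b /=; rewrite sub0r.
apply: filterS (transfer_dom_overlap dpsi) => x xfin _.
rewrite lee_fin indicE; have [/set_mem [Ex _]|_] := boolP (x \in A); last first.
  by rewrite addr_ge0// sqr_ge0.
case: xfin => [[k kx]|->]; last by rewrite /= subr0 expr1n lerDl sqr_ge0.
by have [n /= kn Dn] := Ex k Logic.I; have := kx _ kn.
Qed.

(** * The Perron-Frobenius operator as a branch sum *)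

(** For [psi] in the domain of the transfer operator, the branch sum of
(psi o sigma) xi is psi times that of xi, which is psi eta; branch sums keep
integrals. *)
Lemma perron_frobenius_of_branch_sum (xi eta : T -> R[i]) :
  L2 mu xi -> L2 mu eta ->
  {ae mu, forall x, finite_branch_sum xi x (eta x)} ->
  perron_frobenius mu sigma xi eta.
Proof.
move=> xi2 eta2 S; split => // psi [psi2 Tpsi2].
have [ivr ivi] := L2_mul_integrable psi2 eta2.
have [igr igi] := L2_mul_integrable Tpsi2 xi2.
congr Complex; apply: Rintegral_branch_sum => //;
  apply: filterS S => x /(finite_branch_sum_coding psi).
  by apply: (finite_branch_sum_map (phi := @complex.Re R)) => // -[? ?] [? ?].
by apply: (finite_branch_sum_map (phi := @complex.Im R)) => // -[? ?] [? ?].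
Qed.

(** The measure of [sigma @^-1` A] is the integral over [A] of the number of
domains containing a point, which is at most [k]. This makes the indicator of
[A] an admissible test function. *)
Lemma measure_coding_preimage_lty (A : set T) k : measurable A ->
  (mu A < +oo)%E -> (forall x n, A x -> (k <= n)%N -> ~ D n x) ->
  (mu (sigma @^-1` A) < +oo)%E.
Proof.
move=> mA Aoo Ak; pose SA := sigma @^-1` A.
have mSA : measurable_fun setT (EFin \o (\1_SA : T -> R)).
  exact/measurable_EFinP/measurable_indic/msigma.
rewrite -[X in mu X]setIT -integral_indic; [|exact: measurableT|exact: msigma].
rewrite -(ge0_integral_branch_sum mSA) //; last by move=> x; rewrite /= lee_fin.
apply: (@le_lt_trans _ _ (\int[mu]_x (k%:R%:E * (\1_A x)%:E)))%E; last first.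
  have mA1 : measurable_fun setT (EFin \o (\1_A : T -> R)).
    exact/measurable_EFinP/measurable_indic.
  rewrite (ge0_integralZl_EFin mu measurableT _ mA1)//; last first.
    by move=> x _; rewrite /= lee_fin.
  by rewrite integral_indic// setIT lte_mul_pinfty// lee_fin.
apply: ge0_le_integral => //.
- by move=> x _; apply: nneseries_ge0 => n _ _; rewrite mule_ge0 ?lee_fin.
- by apply: measurable_branch_sum => // x; rewrite /= lee_fin.
- by apply/measurable_EFinP; apply: measurable_funM => //; exact: measurable_indic.
move=> x _.
have E n : ((\1_(D n) x)%:E * (EFin \o \1_SA) (s n x) =
    (\1_(D n) x)%:E * (\1_A x)%:E :> \bar R)%E.
  rewrite indicE; have [/set_mem Dx|_] := boolP (x \in D n); last by rewrite !mul0e.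
  by rewrite /= (_ : \1_SA (s n x) = \1_A (sigma (s n x)))// sK.
under eq_eseriesr do rewrite E.
have [/set_mem Ax|Ax] := boolP (x \in A); last first.
  rewrite indicE (negbTE Ax) mule0 eseries0// => n _ _; exact: mule0.
rewrite indicE mem_set// mule1 (@nneseries_finite _ _ k); first last.
- by move=> n kn; rewrite indicE memNset ?mul0e//; exact: Ak kn.
- by move=> n; rewrite mule_ge0 ?lee_fin.
rewrite sumEFin lee_fin (_ : k%:R = \sum_(0 <= n < k) 1); last first.
  by rewrite sumr_const_nat subn0.
apply: ler_sum => n _; rewrite indicE.
by case: (x \in D n); rewrite mulr1 ?lexx ?ler01.
Qed.

Lemma perron_frobenius_indic (xi eta : T -> R[i]) (A : set T) :
  perron_frobenius mu sigma xi eta -> measurable A -> (mu A < +oo)%E ->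
  (mu (sigma @^-1` A) < +oo)%E ->
  \int[mu]_x (\1_A x * complex.Re (eta x)) =
    \int[mu]_x (\1_A (sigma x) * complex.Re (xi x)) /\
  \int[mu]_x (\1_A x * complex.Im (eta x)) =
    \int[mu]_x (\1_A (sigma x) * complex.Im (xi x)).
Proof.
move=> [_ _ PF] mA Aoo SAoo.
have dA : transfer_dom mu sigma (fun x => Complex (\1_A x : R) 0).
  by split; [exact: L2_indic|exact: (L2_indic (msigma mA))].
have ReM (r : R) (z : R[i]) : complex.Re (Complex r 0 * z) = r * complex.Re z.
  by case: z => a b /=; rewrite mul0r subr0.
have ImM (r : R) (z : R[i]) : complex.Im (Complex r 0 * z) = r * complex.Im z.
  by case: z => a b /=; rewrite mul0r addr0.
have [re im] := PF _ dA; split.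
  transitivity (\int[mu]_x complex.Re (Complex (\1_A x : R) 0 * eta x)).
    by apply: eq_Rintegral => x _; rewrite ReM.
  by rewrite re; apply: eq_Rintegral => x _; rewrite ReM.
transitivity (\int[mu]_x complex.Im (Complex (\1_A x : R) 0 * eta x)).
  by apply: eq_Rintegral => x _; rewrite ImM.
by rewrite im; apply: eq_Rintegral => x _; rewrite ImM.
Qed.

(** The right-hand side of the equation is the integral over [A] of the branch
sum of [f], because the factor 1_A o sigma comes out of the branch sum as 1_A.
Functions with equal integrals over all measurable subsets of [B] agree almost
everywhere on [B]. *)
Lemma branch_sum_determined (f e : T -> R) (B : set T) k :
  {ae mu, forall x, finite_overlap x} ->
  measurable B -> (mu B < +oo)%E ->
  (forall x n, B x -> (k <= n)%N -> ~ D n x) ->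
  f \in Lfun mu 2%:E -> e \in Lfun mu 2%:E ->
  (forall A, measurable A -> A `<=` B -> (mu (sigma @^-1` A) < +oo)%E ->
    \int[mu]_x (\1_A x * e x) = \int[mu]_x (\1_A (sigma x) * f x)) ->
  {ae mu, forall x, B x -> finite_branch_sum f x (e x)}.
Proof.
move=> overlap_ae mB Boo Bk f2 e2 H.
have := sub_Lfun_mfun f2; rewrite inE /= => mf.
have := sub_Lfun_mfun e2; rewrite inE /= => me.
pose v x := series (fun n => \1_(D n) x * f (s n x)) k.
have mv : measurable_fun setT v.
  apply: measurable_sum => n; rewrite (_ : (fun x => _) = (f \o s n) \_ (D n)).
    apply/(measurable_restrictT _ (mD n)); apply: (measurableT_comp mf).
    exact: (sb_measurable sb).
  by rewrite patch_indic; apply/funext => x /=; rewrite mulrC.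
have restr (A : set T) (u : T -> R) : (fun x => (\1_A x * u x)%:E) = (EFin \o u) \_ A.
  by rewrite -indicM_patch.
have i1 A : measurable A -> (mu A < +oo)%E ->
    mu.-integrable setT (fun x => (\1_A x * e x)%:E).
  by move=> mA Aoo; apply/Lfun1_integrable/Lfun2_mul_Lfun1 => //; exact: Lfun2_indic.
suff : ae_eq mu B (EFin \o e) (EFin \o v).
  apply: filterS => x /= Hx Bx; exists k; first by move=> n; exact: Bk.
  by have [->] := Hx Bx.
apply: integral_ae_eq => //.
- have := i1 _ mB Boo; rewrite restr.
  by move/integrable_restrict; rewrite setTI; apply.
- exact/measurable_EFinP/measurable_funTS.
move=> A AB mA; have Aoo : (mu A < +oo)%E.
  by rewrite (le_lt_trans _ Boo)// le_measure ?inE.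
have SAoo : (mu (sigma @^-1` A) < +oo)%E.
  by apply: (measure_coding_preimage_lty (k := k)) => // x n /AB; exact: Bk.
have ig : mu.-integrable setT (fun x => (\1_A (sigma x) * f x)%:E).
  apply/Lfun1_integrable/(@Lfun2_mul_Lfun1 _ _ _ _ (\1_(sigma @^-1` A))) => //.
  by apply: Lfun2_indic => //; exact: msigma.
have vg : (\int[mu]_x (\1_A x * v x)%:E =
    \int[mu]_x (\1_A (sigma x) * f x)%:E)%E.
  apply: (integral_branch_sum ig).
    by apply: measurable_funM => //; exact: measurable_indic.
  apply: filterS overlap_ae => x [k' Dk'].
  have [/set_mem Ax|nAx] := boolP (x \in A).
    apply: (finite_branch_sum_coding \1_A); exists k => // n.
    by move=> kn; apply: Bk kn; exact: AB.
  (* outside [A], where [v x] need not be the complete branch sum *)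
  rewrite (_ : \1_A x * v x =
      \1_A x * series (fun n => \1_(D n) x * f (s n x)) k').
    by apply: (finite_branch_sum_coding \1_A); exists k'.
  by rewrite indicE (negbTE nAx) !mul0r.
rewrite integral_mkcond [RHS]integral_mkcond -!restr vg.
rewrite -[LHS]fineK; last exact: integrable_fin_num (i1 _ mA Aoo).
rewrite -[RHS]fineK; last exact: integrable_fin_num ig.
by congr EFin; exact: H.
Qed.

Lemma perron_frobeniusE (xi eta : T -> R[i]) : sigma_finite setT mu ->
  transfer_densely_defined mu sigma -> L2 mu xi -> L2 mu eta ->
  perron_frobenius mu sigma xi eta <->
  {ae mu, forall x,
     series (fun n => \1_(D n) x * xi (s n x)) @ \oo --> (eta x : R[i]^o)}.
Proof.
move=> fin dense xi2 eta2; have overlap_ae := ae_finite_overlap fin dense.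
have [F FT Foo] := fin.
split=> [PF|S]; last first.
  apply: perron_frobenius_of_branch_sum => //.
  by apply: filterS2 overlap_ae S => x xfin /(cvg_finite_branch_sum _ _ xfin).
(* up to a null set the [C k] exhaust the space by finiteness of the overlaps *)
pose C k := ~` \bigcup_(n in [set n | (k <= n)%N]) D n.
have mC k : measurable (C k).
  by apply: measurableC; exact: bigcup_measurable.
have CD k x n : C k x -> (k <= n)%N -> ~ D n x by move=> Cx kn Dx; apply: Cx; exists n.
have loc k j : {ae mu, forall x, (C k `&` F j) x -> finite_branch_sum xi x (eta x)}.
  have [mF Fj] := Foo j.
  have mB : measurable (C k `&` F j) by exact: measurableI.
  have Boo : (mu (C k `&` F j) < +oo)%E.
    by rewrite (le_lt_trans _ Fj)// le_measure ?inE//; exact: subIsetr.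
  have Bk x n : (C k `&` F j) x -> (k <= n)%N -> ~ D n x by move=> [+ _]; exact: CD.
  have H A : measurable A -> A `<=` C k `&` F j -> (mu (sigma @^-1` A) < +oo)%E -> _ :=
    fun mA AB => perron_frobenius_indic PF mA
      (le_lt_trans (le_measure mu (mem_set mA) (mem_set mB) AB) Boo).
  have [xr xim] := xi2; have [er eim] := eta2.
  have Hr := branch_sum_determined overlap_ae mB Boo Bk xr er
    (fun A mA AB SA => (H A mA AB SA).1).
  have Hi := branch_sum_determined overlap_ae mB Boo Bk xim eim
    (fun A mA AB SA => (H A mA AB SA).2).
  apply: filterS3 overlap_ae Hr Hi => x xfin Hr Hi Bx.
  by apply: finite_branch_sum_of_parts => //; [exact: Hr|exact: Hi].
have := ae_foralln (fun k => ae_foralln (loc k)).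
apply: filterS2 overlap_ae => x xfin Hx.
apply/(cvg_finite_branch_sum _ _ xfin); have [k xk] := xfin.
have [j _ Fj] : (\bigcup_j F j) x by rewrite -FT.
by apply: (Hx k j); split=> // -[n kn Dx]; exact: xk Dx.
Qed.

End UnitWeightSystem.

(** * The comb system *)

Lemma semibranching_reindex d (T : measurableType d) (R : realType)
    (mu : {measure set T -> \bar R}) (I J : Type) (P : set I) (Q : set J)
    (f : I -> J) (D : J -> set T) (s : J -> T -> T) (sigma : T -> T) :
  set_bij P Q f -> semibranching mu Q D s sigma ->
  semibranching mu P (D \o f) (s \o f) sigma.
Proof.
move=> [fPQ finj fsurj] [dom ran ms mS cov dis RN K].
have {}fPQ i : P i -> Q (f i) by move=> Pi; exact: fPQ.
split => //=.
- by move=> i /fPQ; exact: dom.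
- by move=> i /fPQ; exact: ran.
- by move=> i /fPQ; exact: ms.
- by rewrite -(reindex_bigcup f P Q (fun j => s j @` D j)).
- move=> i j Pi Pj ij; apply: dis; [exact: fPQ|exact: fPQ|].
  by apply: contra_not ij; apply: finj; exact: mem_set.
- by move=> i /fPQ; exact: RN.
- by move=> i x /fPQ; exact: K.
Qed.

Theorem theorem5p2 (R : realType) (p : nat) (p_prime : prime p)
  (Cp : padic_complex R p)
  (q : nat -> rat) (q_enum : set_bij setT Q1 q)
  (b : nat -> R) (b01 : forall n, 0 <= b n <= 1)
  (qb : forall n, ratr (q n) < b n)
  (bq0 : (fun n => b n - ratr (q n)) @ \oo --> (0 : R))
  (h : combX q b -> P1Berk Cp) (h_homeo : homeomorphism h)
  (mu : {measure set (combX q b) -> \bar R})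
  (mu_neq0 : mu setT <> 0%E)
  (mu_pos : strictly_positive mu)
  (mu_sfin : sigma_finite setT mu)
  (mu_reg : inner_regular mu)
  (mu_inv : mobius_invariant mu h)
  (sb : semibranching mu Q1 (@Fdom R q b) (@branch R q b) (@seq_shift R q b))
  (RN1 : forall r, Q1 r -> RN_derivative mu (Fdom r) (branch r) (cst 1%E))
  (T_dense : transfer_densely_defined mu (@seq_shift R q b)) :
  forall xi eta : combX q b -> R[i], L2 mu xi -> L2 mu eta ->
    perron_frobenius mu (@seq_shift R q b) xi eta <->
    {ae mu, forall x,
       series (fun n => \1_(Fdom (q n)) x * xi (branch (q n) x)) @ \oo -->
         (eta x : R[i]^o)}.
Proof.
move=> xi eta xi2 eta2; have [qQ1 _ _] := q_enum.
have sbq := semibranching_reindex q_enum sb.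
apply: (perron_frobeniusE sbq) => // n.
by apply: RN1; exact: qQ1.
Qed.
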